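(* Let $G$ be the zero-divisor graph of a po-semiring, with $|V(G)|\geq 2$. Then the following conditions are equivalent: (i) $G$ is triangle-free; (ii) $G$ is a bipartite graph; (iii) $G$ is either a complete bipartite graph or a complete bipartite graph with a horn.
   Context: A commutative semiring is a set $A$ with two distinct elements $0,1$ and two operations $+,\cdot$ such that $(A,+,0)$ and $(A,\cdot,1)$ are commutative monoids, multiplication distributes over addition, and $0\cdot a=0$ for all $a\in A$. A po-semiring is a commutative semiring $(A,+,\cdot,0,1)$ together with a partial order $\le$ on $A$ such that: $x\le y$ implies $x+z\le y+z$; $0\le x$ and $y\le z$ imply $xy\le xz$ (for all $x,y,z\in A$); and $0$ is the least element and $1$ is the largest element of $A$. The zero-divisor graph $\Gamma(A)$ of a po-semiring $A$ is the simple graph whose vertices are the nonzero multiplicative zero-divisors of $A$ (nonzero $x$ with $xy=0$ for some nonzero $y\in A$), distinct vertices $x,y$ being adjacent iff $xy=0$. Graphs are simple and may be finite or infinite. A complete bipartite graph has two nonempty parts (so star graphs are included). A complete bipartite graph with a horn, denoted $X-U-v-Y$, is a graph whose vertex set is a disjoint union $X\cup U\cup\{v\}\cup Y$ with $X,U,Y$ nonempty (of arbitrary cardinality), whose edges are exactly: all pairs between $X$ and $U$, all pairs between $U$ and $\{v\}$, and all pairs between $\{v\}$ and $Y$. *)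

(* Defs.v *)
From mathcomp Require Import all_boot all_algebra.
From mathcomp Require Import boolp classical_sets.

Set Implicit Arguments.
Unset Strict Implicit.
Unset Printing Implicit Defensive.

Import GRing.Theory.
Local Open Scope classical_set_scope.
Local Open Scope ring_scope.

(* comNzSemiRingType includes 0 * a = 0 and 1 != 0.  The order is a field of a
   plain record: Hierarchy-Builder rejects the direct join of porderType and
   comNzSemiRingType, which lacks a common ancestor with POrderedZmodule. *)
Record poSemiRing := POSemiRing {
  po_carrier :> comNzSemiRingType;
  po_le : rel po_carrier;
  po_le_refl : reflexive po_le;
  po_le_anti : antisymmetric po_le;
  po_le_trans : transitive po_le;
  po_leD2r : forall x y z, po_le x y -> po_le (x + z) (y + z);
  po_leM2l : forall x y z, po_le 0 x -> po_le y z -> po_le (x * y) (x * z);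
  po_le0x : forall x, po_le 0 x;
  po_lex1 : forall x, po_le x 1
}.

(* Simple graphs, finite or infinite. *)
Record sgraph := SGraph {
  vertex :> Type;
  adj : vertex -> vertex -> Prop;
  adj_sym : forall x y, adj x y -> adj y x;
  adj_irr : forall x, ~ adj x x
}.

Definition triangle_free (G : sgraph) : Prop :=
  ~ exists x y z : G, [/\ adj x y, adj y z & adj x z].

(* One endpoint in X and the other one in Y, in either order. *)
Definition between (V : Type) (X Y : set V) (x y : V) : Prop :=
  (X x /\ Y y) \/ (Y x /\ X y).

Definition bipartite (G : sgraph) : Prop :=
  exists X Y : set G,
    [/\ X `|` Y = setT, X `&` Y = set0 &
        forall x y : G, adj x y -> between X Y x y].

Definition complete_bipartite (G : sgraph) : Prop :=
  exists X Y : set G,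
    [/\ X !=set0, Y !=set0, X `|` Y = setT, X `&` Y = set0 &
        forall x y : G, adj x y <-> between X Y x y].

(* The graphs X - U - v - Y. *)
Definition complete_bipartite_with_horn (G : sgraph) : Prop :=
  exists (X U : set G) (v : G) (Y : set G),
    [/\ [/\ X !=set0, U !=set0 & Y !=set0],
        X `|` U `|` [set v] `|` Y = setT,
        [/\ X `&` U = set0, X `&` Y = set0 & U `&` Y = set0],
        [/\ ~ X v, ~ U v & ~ Y v] &
        forall x y : G, adj x y <->
          [\/ between X U x y, between U [set v] x y
            | between [set v] Y x y]].

Section ZeroDivisorGraph.
Context (A : poSemiRing).

Definition zero_divisors : set A :=
  [set x | x != 0 /\ exists2 y : A, y != 0 & x * y = 0].

Definition zdg_adj (x y : set_type zero_divisors) : Prop :=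
  x <> y /\ val x * val y = 0.

Lemma zdg_adj_sym x y : zdg_adj x y -> zdg_adj y x.
Proof. by move=> [xy xy0]; split; [exact/nesym | rewrite mulrC]. Qed.

Lemma zdg_adj_irr x : ~ zdg_adj x x.
Proof. by case. Qed.

Definition zero_divisor_graph : sgraph := SGraph zdg_adj_sym zdg_adj_irr.

End ZeroDivisorGraph.

(* Main.v *)
Require Import Defs.
From mathcomp Require Import all_boot all_algebra.
From mathcomp Require Import boolp classical_sets.

(** Both shapes are visibly bipartite, and a bipartite graph has no triangle.
    The content is that a triangle-free zero-divisor graph G with two vertices
    has one of the two shapes, and it is obtained by looking at G from one
    well-chosen vertex a, which splits it into N(a) and the rest.

    N(a) is independent because G is triangle-free.  Suppose that the
    complement of N(a) is independent too, that no vertex is isolated, and that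
    a vertex of N(a) adjacent to one vertex outside N(a) other than a is
    adjacent to all of them.  Then N(a) splits into the vertices adjacent to
    everything outside N(a) and those that are adjacent to a alone while other
    vertices lie outside N(a).  G is complete bipartite if there are none of
    the latter, and otherwise they are the horn, with v = a ([center_shape]).

    The choice of a depends on the elements of square zero.
    - If there are two distinct nonzero elements a, b with
      a^2 = b^2 = ab = 0, then a + b would complete a triangle, so a + b is one
      of them, say a + b = b, hence a <= b.  Then Ann(b) = {0, a, b}, which
      forces every vertex to be killed by a ([star_center]): G is a star.
    - Otherwise a square-zero vertex is taken if there is one, and any vertex
      if there is none.  No neighbour of a then has square zero,
      so that products of vertices differ from the vertices with which they
      are to form a forbidden triangle ([outside_center_indep],
      [inner_neighbor_complete]). *)

Set Implicit Arguments.
Unset Strict Implicit.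
Unset Printing Implicit Defensive.

Import GRing.Theory.
Local Open Scope classical_set_scope.
Local Open Scope ring_scope.

(** * Graphs *)

Section Graphs.
Variable G : sgraph.

Lemma bipartite_triangle_free : bipartite G -> triangle_free G.
Proof.
move=> [X [Y [_ XY0 adjXY]]] [x [y [z [/adjXY xy /adjXY yz /adjXY xz]]]].
have disj t : X t -> Y t -> False.
  by move=> Xt Yt; have : (X `&` Y) t by []; rewrite XY0.
by case: xy yz xz => -[x1 y1] [] [y2 z1] [] [x2 z2];
  by [apply: (disj x) | apply: (disj y) | apply: (disj z)].
Qed.

Lemma complete_bipartite_bipartite : complete_bipartite G -> bipartite G.
Proof.
by move=> [X [Y [_ _ XYT XY0 adjXY]]]; exists X, Y; split=> // x y /adjXY.
Qed.

Lemma horn_bipartite : complete_bipartite_with_horn G -> bipartite G.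
Proof.
move=> [X [U [v [Y [_ cov [XU XY UY] [Xv Uv Yv] adjE]]]]].
exists (X `|` [set v]), (U `|` Y); split.
- by rewrite setUACA setUA.
- rewrite setIUr !setIUl XU XY !set0U -setIUr.
  by apply/seteqP; split=> // x [-> []].
- move=> x y /adjE [] [] [? ?].
  + by left; split; left.
  + by right; split; left.
  + by right; split; [left | right].
  + by left; split; [right | left].
  + by left; split; right.
  + by right; split; right.
Qed.

Lemma complete_bipartite_setC (P : set G) :
  P !=set0 -> ~` P !=set0 ->
  (forall x y, P x -> P y -> ~ adj x y) ->
  (forall x y, ~ P x -> ~ P y -> ~ adj x y) ->
  (forall x y, P x -> ~ P y -> adj x y) ->
  complete_bipartite G.
Proof.
move=> P0 PC0 indP indPC PPC; exists P, (~` P).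
split=> //; [exact: setUv | exact: setICr | move=> x y; split].
  move=> xy; have [Px|nPx] := pselect (P x); have [Py|nPy] := pselect (P y).
  - by case: (indP x y).
  - by left.
  - by right.
  - by case: (indPC x y).
by move=> [[Px nPy]|[nPx Py]]; [exact: PPC | apply/adj_sym/PPC].
Qed.

(** The horn, if any, consists of the neighbours of [a] that miss some vertex
    outside N(a): by the homogeneity hypothesis these see no vertex outside
    N(a) but [a] itself. *)
Lemma center_shape (a : G) :
  triangle_free G ->
  (forall x : G, exists y, adj x y) ->
  (forall z w, ~ adj a z -> ~ adj a w -> ~ adj z w) ->
  (forall u z z', adj a u -> ~ adj a z -> z <> a -> ~ adj a z' ->
     adj u z -> adj u z') ->
  complete_bipartite G \/ complete_bipartite_with_horn G.
Proof.
move=> tfG noiso indC homog.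
have indN x y : adj a x -> adj a y -> ~ adj x y.
  by move=> ax ay xy; apply: tfG; exists a, x, y.
have [full|/existsNP [y0 /existsNP [z0]]] :=
    pselect (forall u z, adj a u -> ~ adj a z -> adj u z).
  left; apply: (@complete_bipartite_setC (adj a)) => //.
  by exists a; exact: adj_irr.
move=> /not_implyP [ay0 /not_implyP [az0 y0z0]]; right.
have z0a : z0 <> a by move=> z0a; apply: y0z0; rewrite z0a; exact: adj_sym.
pose X : set G := [set z | z <> a /\ ~ adj a z].
pose U : set G := [set u | adj a u /\ adj u z0].
pose Y : set G := [set y | adj a y /\ ~ adj y z0].
have UX u x : U u -> X x -> adj u x.
  by move=> [au uz0] [_ ax]; exact: (homog u z0 x).
have YX y x : Y y -> X x -> ~ adj y x.
  by move=> [ay yz0] [xa ax] yx; apply: yz0; exact: (homog y x z0).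
exists X, U, a, Y; split.
- split; [by exists z0 | | by exists y0].
  have [w z0w] := noiso z0.
  exists w; split; last exact: adj_sym.
  by apply: contrapT => aw; exact: indC z0w.
- rewrite -subTset => x _.
  have [->|xa] := pselect (x = a); first by left; right.
  have [ax|nax] := pselect (adj a x); last by left; left; left.
  by have [xz0|xz0] := pselect (adj x z0); [left; left; right | right].
- split; rewrite -subset0 => x [].
  + by move=> [_ ?] [].
  + by move=> [_ ?] [].
  + by move=> [_ ?] [].
- by split=> -[] // /adj_irr.
- move=> x y; split; last first.
    move=> [] [] [].
    + by move=> Xx Uy; apply/adj_sym/UX.
    + by move=> Ux Xy; apply/UX.
    + by move=> [ax _] ->; exact: adj_sym.
    + by move=> -> [].
    + by move=> -> [].
    + by move=> [ax _] ->; exact: adj_sym.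
  (* As N(a) and its complement are independent, an edge has one end in each;
     [u] is the end in N(a). *)
  have main u z : adj u z -> adj a u -> ~ adj a z ->
      (U u /\ X z) \/ (adj a u /\ z = a).
    move=> uz au az; have [za|za] := pselect (z = a); first by right.
    left; split=> //; have [//|uz0] := pselect (adj u z0).
    by case: (YX u z).
  have NUY u : adj a u -> U u \/ Y u.
    by move=> au; have [?|?] := pselect (adj u z0); [left | right].
  move=> xy.
  have [ax|ax] := pselect (adj a x); have [ay|ay] := pselect (adj a y).
  + by case: (indN x y).
  + have [[Ux Xy]|[/NUY[?|?] ->]] := main _ _ xy ax ay.
    * by constructor 1; right.
    * by constructor 2; left.
    * by constructor 3; right.
  + have [[Uy Xx]|[/NUY[?|?] ->]] := main _ _ (adj_sym xy) ay ax.
    * by constructor 1; left.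
    * by constructor 2; right.
    * by constructor 3; left.
  + by case: (indC x y).
Qed.

End Graphs.

(** * Annihilators in a po-semiring *)

Section Annihilators.
Variable A : poSemiRing.
Implicit Types a b c u w x y z : A.
Local Notation G := (zero_divisor_graph A).

Lemma po_le_eq0 x : po_le x 0 -> x = 0.
Proof. by move=> x0; apply: (@po_le_anti A); rewrite x0 po_le0x. Qed.

Lemma po_leDr x y : po_le x (x + y).
Proof. by have := po_leD2r x (po_le0x y); rewrite add0r addrC. Qed.

Lemma ann_mono x y z : po_le x y -> z * y = 0 -> z * x = 0.
Proof.
by move=> xy zy0; apply: po_le_eq0; rewrite -zy0; exact: po_leM2l (po_le0x z) xy.
Qed.

Lemma vertex_exists x y : x != 0 -> y != 0 -> x * y = 0 ->
  exists v : G, val v = x.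
Proof.
move=> x0 y0 xy0; have Zx : zero_divisors x by split=> //; exists y.
by exists (SigSub (mem_set Zx)).
Qed.

Lemma vertexP (v : G) :
  val v != 0 /\ exists2 y : A, y != 0 & val v * y = 0.
Proof. exact: set_mem (valP v). Qed.

(** Unlike in the graph, the three elements are allowed to coincide; all
    forbidden triangles below are products, whose distinctness is the point. *)
Lemma no_triangle : triangle_free G -> forall x y z,
  x != 0 -> y != 0 -> z != 0 -> x * y = 0 -> y * z = 0 -> x * z = 0 ->
  [\/ x = y, y = z | x = z].
Proof.
move=> tfG x y z x0 y0 z0 xy yz xz.
have [[v vx] [w wy]] :
    (exists v : G, val v = x) /\ (exists w : G, val w = y).
  by split; [exact: vertex_exists xy | exact: vertex_exists yz].
have [t tz] : exists t : G, val t = z.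
  by apply: (vertex_exists z0 y0); rewrite mulrC.
have [->|/eqP nxy] := eqVneq x y; first by constructor 1.
have [->|/eqP nyz] := eqVneq y z; first by constructor 2.
have [->|/eqP nxz] := eqVneq x z; first by constructor 3.
case: tfG; exists v, w, t; rewrite /= /zdg_adj vx wy tz.
by split; split=> // eqv; [apply: nxy | apply: nyz | apply: nxz];
  rewrite -?vx -?wy -?tz eqv.
Qed.

(** If [z] had no annihilator but 0 and itself, another vertex [y] would satisfy
    [y * z = z], so whatever kills [y] would kill [z], hence be [z] itself. *)
Lemma no_isolated_vertex :
  (exists x y : G, x <> y) -> forall z : G, exists y : G, adj z y.
Proof.
move=> [x1 [x2 x12]] z; apply: contrapT => /forallNP noadj.
have [z0 [w0 w00 zw0]] := vertexP z.
have annz w : w != 0 -> val z * w = 0 -> w = val z.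
  move=> wn0 zw; apply: contrapT => wz.
  have [v vw] : exists v : G, val v = w.
    by apply: (vertex_exists wn0 z0); rewrite mulrC.
  by apply: (noadj v); split; rewrite ?vw // => zv; apply: wz; rewrite zv.
have zz0 : val z * val z = 0 by rewrite -{2}(annz _ w00 zw0).
have [y yz] : exists y : G, z <> y.
  have [zx|zx] := pselect (z = x1); last by exists x1.
  by exists x2; rewrite zx.
have [y0 [t t0 yt0]] := vertexP y.
have [zy0|zy0] := eqVneq (val z * val y) 0; first by apply: (noadj y).
have zyE : val z * val y = val z by apply: annz; rewrite // mulrA zz0 mul0r.
have tz : t = val z by apply: annz; rewrite // -zyE -mulrA yt0 mulr0.
by move: zy0; rewrite mulrC -tz yt0 eqxx.
Qed.

(** Any [c] killed by [b] is killed by [a <= b], so Ann(b) = {0, a, b} by the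
    absence of triangles.  If [z * w = 0] and [z] does not kill [a], it kills
    neither [a] nor [b]; so [w * b], which is in Ann(b) and killed by [z], is
    0, whence [w] itself is [a] or [b], and [z * w] is not 0. *)
Lemma square_zero_le_kills a b : triangle_free G ->
  a != 0 -> b != 0 -> a != b -> a * b = 0 -> b * b = 0 -> po_le a b ->
  forall z w, w != 0 -> z * w = 0 -> a * z = 0.
Proof.
move=> tfG a0 b0 ab ab0 bb0 leab z w w0 zw0.
have annb c : c != 0 -> c * b = 0 -> c = a \/ c = b.
  move=> c0 cb0; have ca0 := ann_mono leab cb0.
  have [ca|abE|cb] := no_triangle tfG c0 a0 b0 ca0 ab0 cb0; [by left | | by right].
  by rewrite abE eqxx in ab.
rewrite mulrC; have [//|za] := eqVneq (z * a) 0.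
have zb : z * b != 0.
  by apply: contra_neq za => zb; exact: ann_mono zb.
have zann c : c != 0 -> c * b = 0 -> z * c != 0.
  by move=> c0 /(annb _ c0) [] ->.
have wb0 : w * b = 0.
  have [//|wb] := eqVneq (w * b) 0.
  have := zann _ wb; rewrite -mulrA bb0 mulr0 => /(_ erefl).
  by rewrite mulrA zw0 mul0r eqxx.
by have := zann _ w0 wb0; rewrite zw0 eqxx.
Qed.

Lemma star_center a b : triangle_free G ->
  a != 0 -> b != 0 -> a != b -> a * b = 0 -> a * a = 0 -> b * b = 0 ->
  exists c : G, forall z : G, val c * val z = 0.
Proof.
move=> tfG a0 b0 nab ab0 aa0 bb0.
have killer c d : c != 0 -> d != 0 -> c != d -> c * d = 0 -> d * d = 0 ->
    c + d = d -> exists v : G, forall z : G, val v * val z = 0.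
  move=> c0 d0 cd cd0 dd0 cdE; have [v vc] := vertex_exists c0 d0 cd0.
  exists v => z; have [_ [w w0 zw0]] := vertexP z; rewrite vc.
  apply: (square_zero_le_kills tfG c0 d0 cd cd0 dd0 _ w0 zw0).
  by rewrite -cdE; exact: po_leDr.
have s0 : a + b != 0.
  apply: contra_neq a0 => s0; apply: po_le_eq0.
  by rewrite -s0; exact: po_leDr.
have as0 : a * (a + b) = 0 by rewrite mulrDr aa0 ab0 addr0.
have bs0 : b * (a + b) = 0 by rewrite mulrDr bb0 mulrC ab0 addr0.
have [abE|bE|aE] := no_triangle tfG a0 b0 s0 ab0 bs0 as0.
- by rewrite abE eqxx in nab.
- by apply: (killer a b).
- by apply: (killer b a) => //;
    [rewrite eq_sym | rewrite mulrC | rewrite addrC -aE].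
Qed.

(** If [a ^+ 2 = 0] then [z * a] has square zero and is killed by [a], so it is
    [a] itself, and likewise for [w]; then [z * w = 0] would kill [a].  With no
    square-zero elements, [z * a], [w * a] and a neighbour of [a] would form a
    triangle. *)
Lemma outside_center_indep a b : triangle_free G ->
  a != 0 -> b != 0 -> a * b = 0 ->
  (forall c, c != 0 -> a * c = 0 -> c * c = 0 -> c = a) ->
  a * a = 0 \/ (forall c, c * c = 0 -> c = 0) ->
  forall z w, z * a != 0 -> w * a != 0 -> z * w != 0.
Proof.
move=> tfG a0 b0 ab0 sqa aaV z w za wa; apply/eqP => zw0.
have zawa : z * a * (w * a) = 0 by rewrite mulrACA zw0 mul0r.
case: aaV => [aa0|red].
  have fixa x : x * a != 0 -> x * a = a.
    move=> xa; apply: sqa => //; first by rewrite mulrCA aa0 mulr0.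
    by rewrite mulrACA aa0 mulr0.
  by move: zawa; rewrite (fixa z) // mulrCA aa0 mulr0 => _;
    move: a0; rewrite -(fixa z za) -(fixa w wa) mulrA zw0 mul0r eqxx.
have killb x : x * a * b = 0 by rewrite -mulrA ab0 mulr0.
have [e|e|e] := no_triangle tfG za wa b0 zawa (killb w) (killb z).
- by move: zawa; rewrite -e => /red e'; rewrite e' eqxx in za.
- by have := killb w; rewrite -e => /red e'; rewrite e' eqxx in wa.
- by have := killb z; rewrite -e => /red e'; rewrite e' eqxx in za.
Qed.

(** Were [u * z' != 0], it would be a neighbour of [a] adjacent to any
    neighbour [w] of [z'], and [w] is in N(a) too: a triangle.  It differs
    from [a] because [z] kills it but does not kill [a], and from [w] because
    its square would vanish. *)
Lemma inner_neighbor_complete a : triangle_free G -> a != 0 ->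
  (forall c, c != 0 -> a * c = 0 -> c * c = 0 -> c = a) ->
  (forall z w, z * a != 0 -> w * a != 0 -> z * w != 0) ->
  forall u z z' w, a * u = 0 -> z * a != 0 -> z' * a != 0 -> u * z = 0 ->
    w != 0 -> z' * w = 0 -> u * z' = 0.
Proof.
move=> tfG a0 sqa indC u z z' w au0 za z'a uz0 w0 z'w0.
have [//|uz'] := eqVneq (u * z') 0.
have aw0 : a * w = 0.
  rewrite mulrC; have [//|wa] := eqVneq (w * a) 0.
  by have := indC _ _ z'a wa; rewrite z'w0 eqxx.
have auz' : a * (u * z') = 0 by rewrite mulrA au0 mul0r.
have uz'w : u * z' * w = 0 by rewrite -mulrA z'w0 mulr0.
have uz'Na : u * z' <> a.
  by move=> e; move: za; rewrite -e mulrA [z * u]mulrC uz0 mul0r eqxx.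
have [/esym //|e|e] := no_triangle tfG a0 uz' w0 auz' uz'w aw0.
  by case: uz'Na; apply: sqa; rewrite // {2}e.
by move: z'a; rewrite e z'w0 eqxx.
Qed.

Lemma triangle_free_shape :
  (exists x y : G, x <> y) -> triangle_free G ->
  complete_bipartite G \/ complete_bipartite_with_horn G.
Proof.
move=> ntG tfG; have noiso := no_isolated_vertex ntG.
have [[a [b [[a0 b0 ab] [ab0 aa0 bb0]]]]|nosq] := pselect (exists a b,
    [/\ a != 0, b != 0 & a != b] /\ [/\ a * b = 0, a * a = 0 & b * b = 0]).
  have [c killc] := star_center tfG a0 b0 ab ab0 aa0 bb0.
  have adjc (z : G) : ~ adj c z -> z = c.
    move=> ncz; apply: contrapT => zc; apply: ncz.
    by split; [exact/nesym | exact: killc].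
  apply: (center_shape (a := c)) => //.
    by move=> z w /adjc -> ncw.
  by move=> u z z' _ /adjc ->.
have [a [sqa aaV]] : exists a : G,
    (forall c, c != 0 -> val a * c = 0 -> c * c = 0 -> c = val a) /\
    (val a * val a = 0 \/ forall c, c * c = 0 -> c = 0).
  have [[s s0 ss0]|red] := pselect (exists2 s : A, s != 0 & s * s = 0).
    have [a aE] := vertex_exists s0 s0 ss0; exists a; rewrite aE.
    split; last by left.
    move=> c c0 sc0 cc0; have [//|cs] := eqVneq c s; case: nosq.
    by exists s, c; split; split=> //; rewrite eq_sym.
  have {}red c : c * c = 0 -> c = 0.
    move=> cc0; have [//|c0] := eqVneq c 0.
    by case: red; exists c.
  have [a _] := ntG; exists a; split; last by right.
  by move=> c c0 _ /red e; rewrite e eqxx in c0.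
have [a0 _] := vertexP a.
have [b [_ ab0]] := noiso a.
have [b0 _] := vertexP b.
have indC := outside_center_indep tfG a0 b0 ab0 sqa aaV.
have nadj (z : G) : z <> a -> ~ adj a z -> val z * val a != 0.
  move=> za naz; apply/eqP => za0; apply: naz; split; first exact/nesym.
  by rewrite mulrC.
apply: (center_shape (a := a)) => //.
  move=> z w naz naw zw.
  have za : z <> a by move=> e; apply: naw; rewrite -e.
  have wa : w <> a by move=> e; apply: naz; rewrite -e; exact: adj_sym.
  by have /eqP := indC _ _ (nadj _ za naz) (nadj _ wa naw); case: zw.
move=> u z z' au naz za naz' uz.
have [->|z'a] := pselect (z' = a); first exact: adj_sym.
split; first by move=> e; apply: naz'; rewrite -e.
have [w [_ z'w0]] := noiso z'; have [w0 _] := vertexP w.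
by apply: (inner_neighbor_complete tfG a0 sqa indC (z := val z) _ _ _ _ w0 z'w0);
  [case: au | exact: nadj | exact: nadj | case: uz].
Qed.

End Annihilators.

Theorem theorem2p4 (A : poSemiRing) :
  let G := zero_divisor_graph A in
  (exists x y : G, x <> y) ->
  [<-> triangle_free G;
       bipartite G;
       complete_bipartite G \/ complete_bipartite_with_horn G].
Proof.
move=> G ntG.
have shape_bip : complete_bipartite G \/ complete_bipartite_with_horn G ->
    bipartite G.
  by case; [exact: complete_bipartite_bipartite | exact: horn_bipartite].
tfae.
- by move=> tfG; exact/shape_bip/triangle_free_shape.
- by move=> /bipartite_triangle_free; exact: triangle_free_shape.
- by move=> /shape_bip; exact: bipartite_triangle_free.
Qed.
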